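(* (a) If $f\in\mathcal D'(\mathbb R^2)$ then $f\in\mathcal A_c(\mathbb R^2)$ if and only if $\tau_{(s,t)}f\in\mathcal A_c(\mathbb R^2)$ for all $(s,t)\in\mathbb R^2$. (b) Let $f\in\mathcal A_c(\mathbb R^2)$. Then $\lVert f\rVert=\lVert\tau_{(s,t)}f\rVert$ for all $(s,t)\in\mathbb R^2$. (c) Let $f\in\mathcal A_c(\mathbb R^2)$. Then $\lim_{(s,t)\to(0,0)}\lVert f-\tau_{(s,t)}f\rVert=0$.
   Context: $\overline{\mathbb R}=[-\infty,\infty]$ is the two-point compactification of $\mathbb R$, and $\overline{\mathbb R}^2$ carries the product topology. $\mathcal B_c(\overline{\mathbb R}^2)$ is the set of continuous $F:\overline{\mathbb R}^2\to\mathbb R$ with $F(-\infty,s)=F(s,-\infty)=0$ for all $s\in\overline{\mathbb R}$. $\partial_{12}=\partial_1\partial_2$ is the distributional derivative on $\mathbb R^2$, and $\mathcal A_c(\mathbb R^2)=\{f\in\mathcal D'(\mathbb R^2)\mid f=\partial_{12}F\text{ for some }F\in\mathcal B_c(\overline{\mathbb R}^2)\}$; the primitive $F\in\mathcal B_c(\overline{\mathbb R}^2)$ is unique and the Alexiewicz norm is $\lVert f\rVert=\lVert F\rVert_\infty$. For $f\in\mathcal D'(\mathbb R^2)$ and $(s,t)\in\mathbb R^2$ the translation is defined by $\langle\tau_{(s,t)}f,\phi\rangle=\langle f,\tau_{(-s,-t)}\phi\rangle$, where $\tau_{(s,t)}\phi(x,y)=\phi(x-s,y-t)$ for $\phi\in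 C_c^\infty(\mathbb R^2)$. *)

(* Defs.v *)
From HB Require Import structures.
From mathcomp Require Import all_boot all_order all_algebra.
From mathcomp Require Import all_classical all_reals all_analysis.

Set Implicit Arguments.
Unset Strict Implicit.
Unset Printing Implicit Defensive.

Import Order.TTheory GRing.Theory Num.Theory numFieldNormedType.Exports.

Local Open Scope classical_set_scope.
Local Open Scope ring_scope.

Variant axis := axis1 | axis2.

Section partial_derivatives.
Context {R : realType}.
Implicit Types (phi psi : R * R -> R) (i : axis) (w : seq axis) (p h : R * R).

Definition unit_vec i : R * R := if i is axis1 then (1, 0) else (0, 1).

Definition partial i phi : R * R -> R := fun p => 'D_(unit_vec i) phi p.

(* [partials [:: i; j] phi] is [partial i (partial j phi)] *)
Definition partials w phi : R * R -> R := foldr partial phi w.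

Definition smooth phi := forall w,
  continuous (partials w phi) /\
  forall i p, derivable (partials w phi) p (unit_vec i).

Definition tsupport phi : set (R * R) := closure [set p | phi p != 0].

Definition is_testfun : set (R * R -> R) :=
  [set phi | smooth phi /\ compact (tsupport phi)].

Definition testfun_pred : {pred R * R -> R} := mem is_testfun.

Definition fun_translate h phi : R * R -> R := fun p => phi (p - h).

Lemma partials_lin w a phi psi : smooth phi -> smooth psi ->
  partials w (a *: phi + psi) = a *: partials w phi + partials w psi.
Proof.
move=> sphi spsi; elim: w => [//|i w /= ->]; apply/funext => p.
rewrite /partial; have [_ dphi] := sphi w; have [_ dpsi] := spsi w.
by rewrite deriveD ?deriveZ//; exact: derivableZ.
Qed.

Lemma partials_cat w1 w2 phi :
  partials (w1 ++ w2) phi = partials w1 (partials w2 phi).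
Proof. exact: foldr_cat. Qed.

Lemma compact_tsupportS phi psi :
  [set p | psi p != 0] `<=` tsupport phi ->
  compact (tsupport phi) -> compact (tsupport psi).
Proof.
move=> sub cphi; apply: subclosed_compact cphi _; first exact: closed_closure.
by rewrite {2}/tsupport (iffLR (closure_id _) (@closed_closure _ _));
  exact: closureS.
Qed.

Lemma testfun_submod_closed : submod_closed testfun_pred.
Proof.
split.
  rewrite inE; split.
    move=> w; suff -> : partials w (0 : R * R -> R) = cst 0.
      by split=> [p|i p]; [exact: cvg_cst|exact: derivable_cst].
    elim: w => [//|i w /= ->]; apply/funext => p.
    by rewrite /partial derive_cst.
  rewrite /tsupport (_ : [set p | _] = set0) ?closure0; first exact: compact0.
  by apply/seteqP; split=> p //=; rewrite eqxx.
move=> a phi psi /set_mem [sphi cphi] /set_mem [spsi cpsi].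
rewrite inE; split.
  move=> w; rewrite partials_lin//.
  have [cp dp] := sphi w; have [cq dq] := spsi w; split=> [p|i p].
    by apply: cvgD; [apply: cvgZr; exact: cp|exact: cq].
  by apply: derivableD => //; exact: derivableZ.
apply: (@subclosed_compact _ _ (tsupport phi `|` tsupport psi)).
- exact: closed_closure.
- exact: compactU.
- rewrite /tsupport -closureU; apply: closureS => p /=.
  have [phi0|?] := eqVneq (phi p) 0; last by left.
  have [psi0|?] := eqVneq (psi p) 0; last by right.
  by rewrite !fctE phi0 psi0 scaler0 addr0 eqxx.
Qed.

Lemma is_testfun_partial i phi : is_testfun phi -> is_testfun (partial i phi).
Proof.
move=> [sphi cphi]; split.
  by move=> w; have := sphi (rcons w i); rewrite -cats1 partials_cat.
apply: compact_tsupportS cphi => p /= /eqP dphi.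
have [//|Np] := pselect (tsupport phi p); exfalso; apply: dphi.
rewrite /partial -(derive_cst (0 : R) p (unit_vec i)).
apply: near_eq_derive.
have : nbhs p (~` tsupport phi).
  by apply: open_nbhs_nbhs; split=> //; exact/closed_openC/closed_closure.
apply: filterS => q Nq; have [//|phiq] := eqVneq (phi q) 0.
by exfalso; apply: Nq; exact: subset_closure.
Qed.

Lemma partial_translate i h phi :
  partial i (fun_translate h phi) = fun_translate h (partial i phi).
Proof.
apply/funext => p; rewrite /partial [RHS]/fun_translate /derive.
set f := (F in lim (F @ _) = _); set g := (F in _ = lim (F @ _)).
suff -> : f = g by [].
by rewrite /f /g; apply/funext => t /=; rewrite /fun_translate addrA.
Qed.

Lemma partials_translate w h phi :
  partials w (fun_translate h phi) = fun_translate h (partials w phi).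
Proof. by elim: w => [//|i w /= ->]; exact: partial_translate. Qed.

Lemma derivable_translate p v h phi :
  derivable phi (p - h) v -> derivable (fun_translate h phi) p v.
Proof.
rewrite /derivable.
set f := (F in cvg (F @ _) -> _); set g := (F in _ -> cvg (F @ _)).
suff -> : f = g by [].
by rewrite /f /g; apply/funext => t /=; rewrite /fun_translate addrA.
Qed.

Lemma is_testfun_translate h phi :
  is_testfun phi -> is_testfun (fun_translate h phi).
Proof.
have ct k : continuous (fun q : R * R => q - k).
  by move=> q; apply: cvgB; [exact: cvg_id|exact: cvg_cst].
move=> [sphi cphi]; split.
  move=> w; rewrite partials_translate; have [cp dp] := sphi w; split.
    move=> p; rewrite /fun_translate.
    exact: (cvg_comp _ _ (ct h p) (cp (p - h))).
  by move=> i p; exact: derivable_translate.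
have im : compact ((fun q => q - (- h)) @` tsupport phi).
  by apply: continuous_compact cphi; exact: continuous_subspaceT (ct _).
apply: (subclosed_compact _ im); first exact: closed_closure.
rewrite (iffLR (closure_id _) (compact_closed _ im)); last exact: norm_hausdorff.
apply: closureS => p /= phip; exists (p - h); last by rewrite opprK subrK.
exact: subset_closure.
Qed.

End partial_derivatives.

Section testfun.
Context (R : realType).

Record testfun := Testfun {
  testfun_fun :> R * R -> R ;
  testfun_subproof : testfun_fun \in testfun_pred }.

HB.instance Definition _ := [isSub for testfun_fun].
HB.instance Definition _ := gen_eqMixin testfun.
HB.instance Definition _ := gen_choiceMixin testfun.
HB.instance Definition _ :=
  GRing.isSubmodClosed.Build _ _ (testfun_pred (R := R))
    testfun_submod_closed.
HB.instance Definition _ := [SubChoice_isSubLmodule of testfun by <:].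

End testfun.

Section distributions.
Context {R : realType}.
Implicit Types (phi : testfun R) (u : testfun R -> R) (i : axis) (h : R * R).

Lemma testfunP phi : is_testfun phi.
Proof. exact/set_mem/testfun_subproof. Qed.

Definition test_partial i phi : testfun R :=
  Testfun (mem_set (is_testfun_partial i (testfunP phi))).

Definition test_translate h phi : testfun R :=
  Testfun (mem_set (is_testfun_translate h (testfunP phi))).

Definition testfun_cvg (phi_ : nat -> testfun R) phi :=
  (exists2 K : set (R * R),
     compact K & forall n, tsupport (phi_ n) `<=` K) /\
  forall w, {uniform, (fun n => partials w (phi_ n)) @ \oo --> partials w phi}.

Definition is_distribution : set (testfun R -> R) :=
  [set u | scalar u /\
    forall (phi_ : nat -> testfun R) phi, testfun_cvg phi_ phi ->
      u (phi_ n) @[n --> \oo] --> u phi].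

Definition dist_partial i u : testfun R -> R := fun phi => - u (test_partial i phi).

Definition dist_translate h u : testfun R -> R :=
  fun phi => u (test_translate (- h) phi).

Definition regular_dist (g : R * R -> R) : testfun R -> R := fun phi =>
  \int[(@lebesgue_measure R \x @lebesgue_measure R)%E]_p (g p * phi p).

End distributions.

Section continuous_primitive_integral.
Context {R : realType}.
Implicit Types (F : \bar R * \bar R -> R) (f : testfun R -> R).

Definition Bc : set (\bar R * \bar R -> R) :=
  [set F | continuous F /\
    forall s : \bar R, F (-oo%E, s) = 0 /\ F (s, -oo%E) = 0].

Definition finite_restr F : R * R -> R := fun p => F (p.1%:E, p.2%:E).

Definition primitive_of f : set (\bar R * \bar R -> R) :=
  [set F | Bc F /\
    f = dist_partial axis1 (dist_partial axis2 (regular_dist (finite_restr F)))].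

Definition Ac : set (testfun R -> R) :=
  [set f | is_distribution f /\ exists F, primitive_of f F].

(* The primitive of [f] when [f] is in [Ac], in which case it is unique;
   the default value is irrelevant otherwise. *)
Definition primitive f : \bar R * \bar R -> R := xget (cst 0) (primitive_of f).

Definition sup_norm F : R := sup (range (fun p => `|F p|)).

Definition alexiewicz_norm f : R := sup_norm (primitive f).

End continuous_primitive_integral.

(* Main.v *)
Require Import Defs.
From HB Require Import structures.
From mathcomp Require Import all_boot all_order all_algebra.
From mathcomp Require Import all_classical all_reals all_analysis.
From mathcomp Require Import measurable_realfun.
From mathcomp Require Import ring lra.

Set Implicit Arguments.
Unset Strict Implicit.
Unset Printing Implicit Defensive.

Import Order.TTheory GRing.Theory Num.Theory numFieldNormedType.Exports.

Local Open Scope classical_set_scope.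
Local Open Scope ring_scope.

(** The whole proposition follows from two facts about primitives.

    The first one is uniqueness: [f] has at most one primitive in [Bc]
    ([primitive_of_unique]).  If [F] is continuous and its weak mixed
    derivative vanishes, then all mixed differences
    F(a,b) - F(a',b) - F(a,b') + F(a',b') vanish.  To see it, fix a smooth bump
    r supported in [0,e] and let A be a primitive of r(. - a) - r(. - a') and B
    a primitive of r(. - b) - r(. - b').  Both have compact support, so
    A(x)B(y) is a test function, and pairing it with the mixed derivative of
    [F] integrates [F] against four translates of r(x)r(y), with the signs of
    the mixed difference.  After a change of variables this integral is that of
    the mixed difference based at a moving point p, against r(x)r(y); as e gets
    small p is confined to a small neighbourhood of 0, and a nonzero value at 0
    would contradict the vanishing of the integral
    ([mixed_difference_small]).  Letting a' and b' tend to -oo and using that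
    [F] is zero there gives F(a,b) = 0, and density of the finite points gives
    [F] = 0.

    The second one is covariance: if [F] is a primitive of [f], then
    F(x - s, y - t) is a primitive of the translate of [f] by (s, t)
    ([primitive_of_translate]), because Lebesgue measure on the plane is
    translation invariant and translation commutes with derivatives.  Since
    translation by a real number is a homeomorphism of the extended line that
    fixes -oo, the translated function is again in [Bc].

    Part (a) is covariance, its converse being the translation by 0.  Part (b)
    holds because translation permutes the points of the extended plane, hence
    preserves the supremum of |F|.  For part (c) the primitive of the
    difference is F - F(. - (s,t)), and the extended plane is compact while the
    action (p, h) |-> p - h is jointly continuous, so the difference tends to 0
    uniformly ([near_ext_translate]). *)

(* Lebesgue measure is defined on this alias of the real line, so statements
   about measurability in the plane have to mention it. *)
Local Notation mplane R := (measurableTypeR R * measurableTypeR R)%type.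

(** * Borel sets and integrable functions in the plane *)

Section plane_integration.
Context {R : realType}.
Notation leb2 := (@lebesgue_measure R \x @lebesgue_measure R)%E.

Lemma measurable_plane_ball (p : R * R) (e : R) :
  measurable (ball p e : set (mplane R)).
Proof.
rewrite (_ : ball p e = ball p.1 e `*` ball p.2 e)//.
by apply: measurableX; exact: measurable_ball.
Qed.

(** The measurable sets of the plane are generated by rectangles; an open set
    is the union of the countably many balls with rational centre and radius
    1/(n+1) that it contains, and balls for the sup norm are rectangles. *)
Lemma open_plane_measurable (U : set (R * R)) : open U ->
  measurable (U : set (mplane R)).
Proof.
move=> oU.
pose B (q : rat * rat * nat) : set (mplane R) :=
  let b := ball (ratr q.1.1 : R, ratr q.1.2 : R) (q.2.+1%:R^-1 : R) in
  if pselect (b `<=` U) then b else set0.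
rewrite (_ : U = \bigcup_q B q); last first.
  apply/seteqP; split=> [p Up|p [q _]]; last first.
    by rewrite /B; case: pselect => // bU /bU.
  have /nbhs_ballP[e /= e0 eU] : nbhs p U by exact: open_nbhs_nbhs.
  have e20 : 0 < e / 2 by rewrite divr_gt0.
  have [n _ /(_ n (leqnn n)) /= ne] := near_infty_natSinv_lt (PosNum e20).
  have [u] : exists u : rat, ball p.1 (n.+1%:R^-1) (ratr u : R).
    have /rat_in_itvoo[u] : p.1 - n.+1%:R^-1 < p.1 + n.+1%:R^-1 :> R.
      by rewrite ltrBlDr -addrA ltrDl addr_gt0.
    by rewrite in_itv /= => /andP[? ?]; exists u; rewrite ball_itv/= in_itv/=; apply/andP.
  have [v] : exists v : rat, ball p.2 (n.+1%:R^-1) (ratr v : R).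
    have /rat_in_itvoo[v] : p.2 - n.+1%:R^-1 < p.2 + n.+1%:R^-1 :> R.
      by rewrite ltrBlDr -addrA ltrDl addr_gt0.
    by rewrite in_itv /= => /andP[? ?]; exists v; rewrite ball_itv/= in_itv/=; apply/andP.
  move=> bv bu; exists (u, v, n) => //; rewrite /B /=.
  have pb : ball (ratr u : R, ratr v : R) (n.+1%:R^-1 : R) p.
    by split; apply: ball_sym.
  case: pselect => [//|NbU]; exfalso; apply: NbU => q bq; apply: eU.
  apply: (@le_ball _ _ _ (n.+1%:R^-1 + n.+1%:R^-1)).
    by rewrite (splitr e) lerD // ltW.
  by apply: ball_triangle bq; exact: ball_sym.
apply: countable_bigcupT_measurable => // q.
by rewrite /B /=; case: ifP => // _; exact: measurable_plane_ball.
Qed.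

Lemma continuous_plane_measurable (g : R * R -> R) : continuous g ->
  measurable_fun setT (g : mplane R -> measurableTypeR R).
Proof.
move=> /continuousP cg; apply: (measurability _ (RGenOpens.measurableE R)).
move=> _ [_ [a [b ->] <-]]; rewrite setTI; apply: open_plane_measurable.
exact/cg/interval_open.
Qed.

Lemma compact_plane_box (K : set (R * R)) : compact K ->
  exists2 M : R, 0 < M & K `<=` ball (0 : R * R) M.
Proof.
move=> /compact_bounded[M [_ /(_ (`|M| + 1))]].
have M1 : M < `|M| + 1 by rewrite ltr_pwDr// ler_norm.
move=> /(_ M1) KM; exists (`|M| + 2); first by rewrite ltr_pwDr.
move=> p /KM; rewrite -ball_normE/= sub0r normrN => /le_lt_trans; apply.
by rewrite ltrD2l; lra.
Qed.

Lemma leb2_ball (p : R * R) (e : R) : 0 <= e ->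
  leb2 (ball p e) = ((e *+ 2) ^+ 2)%:E.
Proof.
move=> e0; rewrite (_ : ball p e = ball p.1 e `*` ball p.2 e)//.
transitivity (lebesgue_measure (ball p.1 e) * lebesgue_measure (ball p.2 e))%E.
  by apply: product_measure1E; exact: measurable_ball.
by rewrite !lebesgue_measure_ball// -EFinM expr2.
Qed.

Lemma integrable_plane_ball (p : R * R) (e : R) : 0 <= e ->
  leb2.-integrable setT (EFin \o \1_(ball p e)).
Proof.
move=> e0; have mB := measurable_plane_ball p e.
apply/integrableP; split; first by apply/measurable_EFinP; exact: measurable_indic.
under eq_integral do rewrite /= ger0_norm//.
rewrite integral_indic// setIT.
by apply: (@le_lt_trans _ _ ((e *+ 2) ^+ 2)%:E); rewrite ?ltry// -(leb2_ball p).
Qed.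

Lemma integrable_compactly_supported (g : R * R -> R) (K : set (R * R)) :
  continuous g -> compact K -> [set p | g p != 0] `<=` K ->
  leb2.-integrable setT (EFin \o g).
Proof.
move=> cg cK gK.
have [M M0 KM] := compact_plane_box cK.
have [C C0 gC] : exists2 C : R, 0 <= C & forall p, `|g p| <= C.
  have : compact (g @` K) by apply: continuous_compact => //; exact: continuous_subspaceT.
  move=> /compact_bounded[C [_ /(_ (`|C| + 1))]].
  have C1 : C < `|C| + 1 by rewrite ltr_pwDr// ler_norm.
  move=> /(_ C1) gC; exists (`|C| + 1) => [|p]; first by rewrite addr_ge0.
  have [->|gp] := eqVneq (g p) 0; first by rewrite normr0 addr_ge0.
  by apply: gC; exists p => //; exact: gK.
have mB := measurable_plane_ball (0 : R * R) M.
apply: (@le_integrable _ _ _ leb2 setT measurableT _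
    (EFin \o (fun p => C * \1_(ball (0 : R * R) M) p))).
- apply/measurable_EFinP; exact: continuous_plane_measurable.
- move=> p _ /=; rewrite lee_fin [leRHS]ger0_norm ?mulr_ge0//.
  have [->|gp] := eqVneq (g p) 0; first by rewrite normr0 mulr_ge0.
  by rewrite indicE mem_set ?mulr1//; exact/KM/gK.
- rewrite (_ : _ \o _ = fun p => (C%:E * (\1_(ball (0 : R * R) M) p)%:E)%E).
    2: by apply/funext => p /=; rewrite EFinM.
  apply: integrableZl => //.
  exact/integrable_plane_ball/ltW.
Qed.

Lemma lebesgue_measure_translate (a : R) (A : set R) : measurable A ->
  pushforward lebesgue_measure ((fun x => x + a) : R -> measurableTypeR R) A =
  lebesgue_measure A.
Proof.
have mt : measurable_fun setT ((fun x => x + a) : measurableTypeR R -> measurableTypeR R).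
  exact: measurable_funD.
move=> mA; apply/esym.
pose mt' := isMeasurableFun.Build _ _ _ _ _ mt.
pose T : {mfun measurableTypeR R >-> measurableTypeR R} :=
  HB.pack ((fun x => x + a) : measurableTypeR R -> measurableTypeR R) mt'.
apply: (lebesgue_measure_unique (mu := pushforward lebesgue_measure T)) => //.
move=> _ [[u v]] _ <-/=.
rewrite /pushforward (_ : _ @^-1` _ = `](u - a), (v - a)]%classic); last first.
  by apply/seteqP; split=> x /=; rewrite !in_itv/= ltrBlDr lerBrDr.
rewrite !lebesgue_measure_itv/= !lte_fin ltrD2r -!EFinB.
by congr (if _ then _%:E else _); lra.
Qed.

End plane_integration.

(** * Translation invariance of Lebesgue measure in the plane *)

Section plane_translation.
Context {R : realType}.
Notation leb2 := (@lebesgue_measure R \x @lebesgue_measure R)%E.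

Lemma measurable_plane_translate (h : R * R) :
  measurable_fun setT ((fun p => p + h) : mplane R -> mplane R).
Proof.
by apply/measurable_fun_pairP; split; apply: measurable_funD.
Qed.

(** A translate of a rectangle is the rectangle of the translates, so the
    translated measure agrees with the product measure on rectangles and
    [product_measure_unique] applies. *)
Lemma leb2_translate (h : R * R) (X : set (R * R)) :
  measurable (X : set (mplane R)) ->
  pushforward leb2 ((fun p => p + h) : mplane R -> mplane R) X = leb2 X.
Proof.
move=> mX; apply/esym.
pose t : mplane R -> mplane R := fun p => p + h.
pose T : {mfun mplane R >-> mplane R} := HB.pack t
  (isMeasurableFun.Build _ _ _ _ t (measurable_plane_translate h)).
apply: (product_measure_unique (m' := pushforward leb2 T)) => // A B mA mB /=.
rewrite /pushforward (_ : T @^-1` _ =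
  ((fun x => x + h.1) @^-1` A) `*` ((fun x => x + h.2) @^-1` B))//.
have mt (a : R) (C : set R) : measurable C ->
    measurable ((fun x => x + a) @^-1` C : set (measurableTypeR R)).
  move=> mC; rewrite -[X in measurable X]setTI.
  have : measurable_fun setT ((fun x => x + a) : measurableTypeR R -> measurableTypeR R).
    exact: measurable_funD.
  exact.
rewrite [LHS]product_measure1E; [|exact: mt..].
by congr (_ * _)%E; apply: lebesgue_measure_translate.
Qed.

Lemma Rintegral_translate (h : R * R) (g : R * R -> R) :
  measurable_fun setT (g : mplane R -> measurableTypeR R) ->
  leb2.-integrable setT (EFin \o (fun p => g (p + h))) ->
  \int[leb2]_p g (p + h) = \int[leb2]_p g p.
Proof.
move=> mg ig; rewrite /Rintegral; congr fine.
pose t : mplane R -> mplane R := fun p => p + h.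
pose T : {mfun mplane R >-> mplane R} := HB.pack t
  (isMeasurableFun.Build _ _ _ _ t (measurable_plane_translate h)).
transitivity (\int[pushforward leb2 T]_p (g p)%:E)%E.
  rewrite integral_pushforward//.
  exact/measurable_EFinP.
apply: eq_measure_integral => A mA _.
exact: leb2_translate.
Qed.

End plane_translation.

(** * Smooth functions of one variable *)

Section smooth_functions.
Context {R : realType}.
Implicit Types (f g : R -> R) (P : {poly R}).

Fixpoint times_derivable n f : Prop :=
  if n is m.+1 then
    exists2 g, (forall x : R, is_derive x 1 f (g x)) & times_derivable m g
  else True.

(** Smoothness is phrased through successive derivative functions, level by
    level, so that closure under sums, products and affine substitutions is
    proved by induction on the order of differentiability. *)
Definition Cinfty f := forall n, times_derivable n f.

Lemma times_derivable_le m n f : (m <= n)%N ->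
  times_derivable n f -> times_derivable m f.
Proof.
elim: m n f => [//|m IH] [//|n] f; rewrite ltnS => mn [g fg /(IH _ _ mn)].
by exists g.
Qed.

Lemma times_derivableD n f g : times_derivable n f -> times_derivable n g ->
  times_derivable n (f + g).
Proof.
elim: n f g => [//|n IH] f g [f' ff' nf] [g' gg' ng].
by exists (f' + g'); [move=> x; exact: is_deriveD|exact: IH].
Qed.

Lemma times_derivableM n f g : times_derivable n f -> times_derivable n g ->
  times_derivable n (f * g).
Proof.
elim: n f g => [//|n IH] f g nf ng.
have lf := times_derivable_le (leqnSn n) nf.
have lg := times_derivable_le (leqnSn n) ng.
case: nf ng => [f' ff' nf] [g' gg' ng].
exists (f * g' + g * f'); first by move=> x; exact: is_deriveM.
by apply: times_derivableD; exact: IH.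
Qed.

Lemma is_derive_comp_affine (c d : R) f g : (forall x : R, is_derive x 1 f (g x)) ->
  forall x : R, is_derive x 1 (fun y => f (c * y + d)) (c * g (c * x + d)).
Proof.
move=> fg x; have dl : is_derive x 1 (fun y : R => c * y + d) c.
  have := is_deriveD (is_deriveZ c (is_derive_id x (1 : R))) (is_derive_cst d x 1).
  by rewrite addr0 /GRing.scale /= mulr1.
by rewrite mulrC; exact: (@is_derive1_comp _ f (fun y => c * y + d)).
Qed.

Lemma times_derivableZ n (c : R) f :
  times_derivable n f -> times_derivable n (fun x => c * f x).
Proof.
elim: n f => [//|n IH] f [g fg ng]; exists (fun x => c * g x); last exact: IH.
by move=> x; exact: (@is_deriveZ _ _ _ f c x 1 (g x)).
Qed.

Lemma times_derivable_affine n (c d : R) f :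
  times_derivable n f -> times_derivable n (fun x => f (c * x + d)).
Proof.
elim: n f => [//|n IH] f [g fg ng].
exists (fun x => c * g (c * x + d)); first exact: is_derive_comp_affine.
exact/times_derivableZ/IH.
Qed.

Lemma Cinfty_derive f : Cinfty f ->
  exists2 g, (forall x : R, is_derive x 1 f (g x)) & Cinfty g.
Proof.
move=> Cf; have [g fg _] := Cf 1; exists g => // n.
have [g' fg' ng'] := Cf n.+1; suff -> : g = g' by [].
apply/funext => x; have [_ <-] := fg x; by have [_ <-] := fg' x.
Qed.

Lemma Cinfty_continuous f : Cinfty f -> continuous f.
Proof.
move=> /(_ 1)[g fg _] x; have [df _] := fg x.
exact/differentiable_continuous/derivable1_diffP.
Qed.

(** The functions P(1/x) exp(-1/x), extended by 0 to x <= 0.  This family,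
    and not only its member with P = 1, is considered because it is closed
    under differentiation. *)
Definition flat P (x : R) : R :=
  if 0 < x then P.[x^-1] * expR (- x^-1) else 0.

(** The exponential beats every power: y^(i+2) <= (i+2)! exp(y) with y = 1/x,
    applied to each coefficient of P.  The quadratic decay at 0 is what makes
    [flat P] differentiable there, with derivative 0. *)
Lemma flat_bound P : exists2 C : R, 0 <= C &
  forall x, `|flat P x| <= C * x ^+ 2.
Proof.
have key i (y : R) : 0 < y -> y ^+ i * expR (- y) <= (i.+2)`!%:R / y ^+ 2.
  move=> y0; rewrite expRN ler_pdivrMr ?expR_gt0// mulrAC.
  rewrite ler_pdivlMr ?exprn_gt0// -exprD addn2.
  rewrite mulrC -ler_pdivrMr ?ltr0n ?fact_gt0//.
  by apply: le_trans (expR_ge1Dxn i.+1 (ltW y0)); rewrite lerDr.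
exists (\sum_(i < size P) `|P`_i| * (i.+2)`!%:R).
  by apply: sumr_ge0 => i _; rewrite mulr_ge0.
move=> x; rewrite /flat; case: ifPn => [x0|_]; last first.
  by rewrite normr0 mulr_ge0 ?sqr_ge0 ?sumr_ge0// => i _; rewrite mulr_ge0.
have y0 : 0 < x^-1 by rewrite invr_gt0.
rewrite horner_coef !mulr_suml (le_trans (ler_norm_sum _ _ _))// ler_sum// => i _.
rewrite !normrM -!mulrA ler_wpM2l// (ger0_norm (expR_ge0 _)).
rewrite (ger0_norm (exprn_ge0 _ (ltW y0))).
by rewrite (le_trans (key i _ y0))// exprVn invrK.
Qed.

(** The derivative of P(1/x) exp(-1/x) is (P(1/x) - P'(1/x)) exp(-1/x) / x^2,
    which is the member of the family for X^2 (P - P'). *)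
Lemma is_derive_flat P (x : R) :
  is_derive x 1 (flat P) (flat ('X^2 * (P - P^`())) x).
Proof.
set Q := _ * _; have [x0|x0|->] := ltgtP x 0.
- have -> : flat Q x = 0 by rewrite /flat ltNge (ltW x0).
  apply: (near_eq_is_derive (f := cst 0)).
  near=> y; rewrite /flat ltNge ifF//; apply/negbF.
  by near: y; apply: filterS (lt_nbhsl x0) => y /ltW.
- have -> : flat Q x = Q.[x^-1] * expR (- x^-1) by rewrite /flat x0.
  have dV : is_derive x 1 (fun y : R => y^-1) (- x ^- 2).
    apply: (@is_derive_eq _ _ _ _ _ _ _ _ (is_deriveV (f := id) _ _)).
      by rewrite gt_eqF.
    by rewrite /GRing.scale/= mulr1.
  have dP : is_derive x 1 (fun y : R => P.[y^-1]) (P^`().[x^-1] * (- x ^- 2)).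
    exact: (@is_derive1_comp _ (horner P) (fun y => y^-1)).
  have dE : is_derive x 1 (fun y : R => expR (- y^-1)) (expR (- x^-1) * (- - x ^- 2)).
    have dN := is_deriveN dV.
    exact: (@is_derive1_comp _ expR (fun y => - y^-1)).
  apply: (near_eq_is_derive (f := (fun y => P.[y^-1]) * (fun y => expR (- y^-1)))).
    near=> y; rewrite /flat ifT//.
    by near: y; exact: lt_nbhsr.
  apply: is_derive_eq (is_deriveM dP dE) _.
  by rewrite /Q hornerM hornerXn hornerD hornerN exprVn /GRing.scale/=; ring.
- have -> : flat Q 0 = 0 by rewrite /flat ltxx.
  have [C C0 PC] := flat_bound P.
  have Ch0 : C * `|h| @[h --> (0 : R)^'] --> (0 : R).
    have := @norm_continuous _ R 0; rewrite /continuous_at normr0.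
    move=> /cvg_within_filter n0.
    by have := cvgM (cvg_cst C) (n0 _); rewrite mulr0; exact.
  have lim0 : h^-1 *: ((flat P \o shift 0) (h *: (1 : R)) - flat P 0)
      @[h --> 0^'] --> (0 : R).
    apply: (@squeeze_cvgr _ _ _ _ (fun h => - (C * `|h|)) (fun h => C * `|h|)).
    + near=> h; rewrite -ler_norml /flat ltxx subr0 /= addr0 /GRing.scale/= mulr1.
      have h0 : h != 0 by near: h; exact: nbhs_dnbhs_neq.
      rewrite normrM normfV ler_pdivrMl ?normr_gt0//.
      by rewrite mulrCA -expr2 real_normK ?num_real//; exact: PC.
    + by have := cvgN Ch0; rewrite oppr0; exact.
    + exact: Ch0.
  apply: DeriveDef; first by apply/cvg_ex; exists 0.
  by apply/cvg_lim => //; exact: Rhausdorff.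
Unshelve. all: by end_near. Qed.

Lemma Cinfty_flat P : Cinfty (flat P).
Proof.
move=> n; elim: n P => [//|n IH] P.
by exists (flat ('X^2 * (P - P^`()))) => // x; exact: is_derive_flat.
Qed.

Definition smooth_bump (e x : R) : R := flat 1 x * flat 1 (-1 * x + e).

Lemma Cinfty_smooth_bump e : Cinfty (smooth_bump e).
Proof.
move=> n; apply: times_derivableM; first exact: Cinfty_flat.
exact/times_derivable_affine/Cinfty_flat.
Qed.

Lemma flat1_ge0 x : 0 <= flat 1 x.
Proof. by rewrite /flat; case: ifP => // _; rewrite hornerC mul1r expR_ge0. Qed.

Lemma smooth_bump_ge0 e x : 0 <= smooth_bump e x.
Proof. by rewrite mulr_ge0 ?flat1_ge0. Qed.

Lemma smooth_bump_gt0 e x : 0 < x < e -> 0 < smooth_bump e x.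
Proof.
move=> /andP[x0 xe]; rewrite /smooth_bump /flat x0 ifT; last first.
  by rewrite mulN1r addrC subr_gt0.
by rewrite !hornerC !mul1r mulr_gt0// expR_gt0.
Qed.

Lemma smooth_bump_eq0 e x : ~~ (0 < x < e) -> smooth_bump e x = 0.
Proof.
rewrite /smooth_bump /flat mulN1r addrC subr_gt0; case: ifP => _; rewrite ?mul0r//.
by case: ifP => _; rewrite ?mulr0.
Qed.

End smooth_functions.

(** * Test functions that are tensor products *)

Section tensor_test_functions.
Context {R : realType}.
Implicit Types (f A B : R -> R).

(** The primitive is constant on each side of the support of [f]; this is what
    makes the difference of two of its translates compactly supported. *)
Lemma Cinfty_primitive f (a b : R) : a <= b ->
  Cinfty f -> (forall x, ~~ (a < x < b) -> f x = 0) ->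
  exists S : R -> R, [/\ forall x : R, is_derive x 1 S (f x), Cinfty S,
    forall x y, x <= a -> y <= a -> S x = S y &
    forall x y, b <= x -> b <= y -> S x = S y].
Proof.
move=> ab Cf f0; have cf := Cinfty_continuous Cf.
have intf : (@lebesgue_measure R).-integrable setT (EFin \o f).
  have : (@lebesgue_measure R).-integrable `[a, b] (EFin \o f).
    apply: (@continuous_compact_integrable R f `[a, b]).
      exact: segment_compact.
    exact: continuous_subspaceT.
  rewrite integrable_mkcond//; congr integrable.
  apply/funext => x; rewrite patchE; case: ifPn => //.
  rewrite notin_setE /= in_itv/= => /negP nx; rewrite f0//.
  by apply: contra nx => /andP[/ltW -> /ltW ->].
pose S x := \int[lebesgue_measure]_(t in `]-oo, x]) f t.
have dS (x : R) : is_derive x 1 S (f x).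
  have xu : x < x + 1 by rewrite ltrDl.
  have intx : (@lebesgue_measure R).-integrable `]-oo, x + 1] (EFin \o f).
    exact: integrableS intf.
  have [dS eS] := @continuous_FTC1 R f -oo%O x (x + 1) xu intx (ltNyr _) (cf x).
  by split; [exact: dS|rewrite -derive1E; exact: eS].
have Sc u v : u <= v -> (forall x, u <= x <= v -> f x = 0) -> S u = S v.
  move=> uv uv0; apply/eqP; rewrite eq_sym -subr_eq0; apply/eqP.
  have [c /[!in_itv]/= /uv0 fc ->] : exists2 c, c \in `[u, v] & S v - S u = f c * (v - u).
    apply: MVT_segment => //; apply: continuous_subspaceT => x.
    by have [dSx _] := dS x; exact/differentiable_continuous/derivable1_diffP.
  by rewrite fc mul0r.
have Scst (D : set R) : (forall u v x, D u -> D v -> u <= x <= v -> f x = 0) ->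
    forall u v, D u -> D v -> S u = S v.
  move=> D0 u v Du Dv; have [uv|/ltW vu] := leP u v.
    by apply: Sc => // x; exact: D0.
  by apply/esym/Sc => // x; exact: D0.
exists S; split => //.
- case=> [//|n]; exists f => //; exact: Cf.
- apply: (Scst [set x | x <= a]) => u v x _ /= va /andP[_ xv]; apply: f0.
  by rewrite ltNge (le_trans xv va).
- apply: (Scst [set x | b <= x]) => u v x /= bu _ /andP[ux _]; apply: f0.
  by rewrite andbC ltNge (le_trans bu ux).
Qed.

(** With S a primitive of the bump, A(x) = S(x - a) - S(x - a') vanishes far to
    the left and far to the right, where S(x - a) and S(x - a') are the same
    constant. *)
Lemma Cinfty_primitive_bumpB (e a a' : R) : 0 < e -> exists A,
  [/\ Cinfty A,
    forall x : R, is_derive x 1 A (smooth_bump e (x - a) - smooth_bump e (x - a')) &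
    exists M, forall x, M < `|x| -> A x = 0].
Proof.
move=> e0.
have [S [dS CS S1 S2]] :=
  Cinfty_primitive (ltW e0) (Cinfty_smooth_bump e) (@smooth_bump_eq0 _ e).
exists (fun x => S (1 * x + - a) + (-1) * S (1 * x + - a')); split.
- move=> n; apply: times_derivableD; first exact: times_derivable_affine.
  exact/times_derivableZ/times_derivable_affine.
- move=> x; rewrite -[x - a]mul1r -[x - a']mul1r.
  have d1 := is_derive_comp_affine 1 (- a) dS x.
  have d2 := is_derive_comp_affine 1 (- a') dS x.
  have := is_deriveB d1 d2; rewrite !mul1r.
  set F := (F in is_derive _ _ F _ -> _); set G := (F in _ -> is_derive _ _ F _).
  suff -> : F = G by [].
  by apply/funext => y; rewrite /F /G mulN1r.
(* Beyond this bound x - a and x - a' are both negative or both above e. *)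
- exists (e + `|a| + `|a'|) => x Mx; rewrite mulN1r !mul1r; apply/eqP.
  rewrite subr_eq0; apply/eqP.
  have := ler_norm a; have := ler_norm a'.
  have := ler_norm (- a); have := ler_norm (- a'); rewrite !normrN => *.
  by case: (ltP 0 x) Mx => [x0|x0]; rewrite ?(gtr0_norm x0) ?(ler0_norm x0) => Mx;
    [apply: S2|apply: S1]; lra.
Qed.

Definition tensor A B (p : R * R) : R := A p.1 * B p.2.

Lemma is_derive_tensor1 A A' B (p : R * R) : is_derive p.1 1 A (A' p.1) ->
  is_derive p (unit_vec axis1) (tensor A B) (A' p.1 * B p.2).
Proof.
move=> [dA <-].
have lim : h^-1 *: ((tensor A B \o shift p) (h *: unit_vec axis1) - tensor A B p)
    @[h --> 0^'] --> 'D_1 A p.1 * B p.2.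
  rewrite [X in X @ _ --> _](_ : _ =
      fun h => (h^-1 *: (A (h *: (1 : R) + p.1) - A p.1)) * B p.2).
    exact: cvgM dA (cvg_cst (B p.2)).
  apply/funext => h; rewrite /tensor /= /GRing.scale/= mulr0 add0r.
  by rewrite -mulrBl mulrA.
apply: DeriveDef; first by apply/cvg_ex; exists ('D_1 A p.1 * B p.2).
by apply/cvg_lim => //; exact: Rhausdorff.
Qed.

Lemma is_derive_tensor2 A B B' (p : R * R) : is_derive p.2 1 B (B' p.2) ->
  is_derive p (unit_vec axis2) (tensor A B) (A p.1 * B' p.2).
Proof.
move=> [dB <-].
have lim : h^-1 *: ((tensor A B \o shift p) (h *: unit_vec axis2) - tensor A B p)
    @[h --> 0^'] --> A p.1 * 'D_1 B p.2.
  rewrite [X in X @ _ --> _](_ : _ =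
      fun h => A p.1 * (h^-1 *: (B (h *: (1 : R) + p.2) - B p.2))).
    exact: cvgM (cvg_cst (A p.1)) dB.
  apply/funext => h; rewrite /tensor /= /GRing.scale/= mulr0 add0r.
  by rewrite -mulrBr mulrCA.
apply: DeriveDef; first by apply/cvg_ex; exists (A p.1 * 'D_1 B p.2).
by apply/cvg_lim => //; exact: Rhausdorff.
Qed.

Lemma partial_tensor1 A A' B : (forall x : R, is_derive x 1 A (A' x)) ->
  partial axis1 (tensor A B) = tensor A' B.
Proof. by move=> dA; apply/funext => p; have [_] := is_derive_tensor1 B (dA p.1). Qed.

Lemma partial_tensor2 A B B' : (forall x : R, is_derive x 1 B (B' x)) ->
  partial axis2 (tensor A B) = tensor A B'.
Proof. by move=> dB; apply/funext => p; have [_] := is_derive_tensor2 A (dB p.2). Qed.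

Lemma continuous_tensor A B : continuous A -> continuous B -> continuous (tensor A B).
Proof.
move=> cA cB p; apply: cvgM.
  by apply: (cvg_comp _ _ (@cvg_fst _ _ _ _ _)); exact: cA.
by apply: (cvg_comp _ _ (@cvg_snd _ _ _ _ _)); exact: cB.
Qed.

(** Every iterated partial derivative of A(x)B(y) is again a product of smooth
    functions of one variable, so it suffices to treat such products. *)
Lemma smooth_tensor A B : Cinfty A -> Cinfty B -> smooth (tensor A B).
Proof.
move=> CA CB w.
have [A' [B' [CA' CB' ->]]] : exists A' B',
    [/\ Cinfty A', Cinfty B' & partials w (tensor A B) = tensor A' B'].
  elim: w => [|i w [A' [B' [CA' CB' /= ->]]]]; first by exists A, B.
  case: i.
    have [A'' dA CA''] := Cinfty_derive CA'; exists A'', B'; split => //.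
    exact: partial_tensor1.
  have [B'' dB CB''] := Cinfty_derive CB'; exists A', B''; split => //.
  exact: partial_tensor2.
split; first by apply: continuous_tensor; exact: Cinfty_continuous.
case=> p.
  have [A'' dA _] := Cinfty_derive CA'.
  by have [] := is_derive_tensor1 B' (dA p.1).
have [B'' dB _] := Cinfty_derive CB'.
by have [] := is_derive_tensor2 A' (dB p.2).
Qed.

Lemma is_testfun_tensor A B : Cinfty A -> Cinfty B ->
  (exists M, forall x, M < `|x| -> A x = 0) ->
  (exists M, forall x, M < `|x| -> B x = 0) -> is_testfun (tensor A B).
Proof.
move=> CA CB [M AM] [N BN]; split; first exact: smooth_tensor.
have cK : compact (`[- M, M]%classic `*` `[- N, N]%classic : set (R * R)).
  by apply: compact_setX; exact: segment_compact.
apply: (subclosed_compact _ cK); first exact: closed_closure.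
rewrite (iffLR (closure_id _) (compact_closed _ cK)); last exact: norm_hausdorff.
apply: closureS => p /=; rewrite mulf_eq0 negb_or => /andP[Ap Bp].
split; rewrite /= in_itv/= -ler_norml leNgt; apply/negP.
- by move=> /AM Ap0; rewrite Ap0 eqxx in Ap.
- by move=> /BN Bp0; rewrite Bp0 eqxx in Bp.
Qed.

End tensor_test_functions.

(** * Continuous functions with vanishing weak mixed derivative *)

Lemma continuous_translate {R : realType} (k : R * R) (g : R * R -> R) :
  continuous g -> continuous (fun p : R * R => g (p + k)).
Proof.
move=> cg p.
have ck : (fun q : R * R => q + k) @ p --> p + k.
  by apply: cvgD; [exact: cvg_id|exact: cvg_cst].
exact: (cvg_comp _ _ ck (cg (p + k))).
Qed.
Arguments continuous_translate {R} k {g} _ _.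

Definition mixed_difference {R : realType} (g : R * R -> R) (a a' b b' : R)
    (p : R * R) : R :=
  (g (p + (a, b)) - g (p + (a', b))) - (g (p + (a, b')) - g (p + (a', b'))).

Lemma continuous_mixed_difference {R : realType} (g : R * R -> R) (a a' b b' : R) :
  continuous g -> continuous (mixed_difference g a a' b b').
Proof.
by move=> cg p; apply: cvgB; apply: cvgB; exact: continuous_translate.
Qed.

Section weak_mixed_derivative.
Context {R : realType}.
Notation leb2 := (@lebesgue_measure R \x @lebesgue_measure R)%E.
Context (e : R) (e0 : 0 < e).
Let bump2 : R * R -> R := tensor (smooth_bump e) (smooth_bump e).

Let continuous_bump2 : continuous bump2.
Proof. by apply: continuous_tensor; exact/Cinfty_continuous/Cinfty_smooth_bump. Qed.

Let bump2_neq0 p : bump2 p != 0 -> (0 < p.1 < e) && (0 < p.2 < e).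
Proof.
rewrite mulf_eq0 negb_or => /andP[p1 p2]; apply/andP; split.
- by apply: contraR p1 => /smooth_bump_eq0/eqP.
- by apply: contraR p2 => /smooth_bump_eq0/eqP.
Qed.

Let bump2_ge0 p : 0 <= bump2 p.
Proof. by rewrite mulr_ge0// smooth_bump_ge0. Qed.

Let bump2_gt0 : 0 < bump2 (e / 2, e / 2).
Proof.
have e2 : 0 < smooth_bump e (e / 2) by apply: smooth_bump_gt0; move: e0 => ?; lra.
exact: mulr_gt0.
Qed.

Let integrable_Mbump2 (g : R * R -> R) (k : R * R) : continuous g ->
  leb2.-integrable setT (EFin \o (fun p => g p * bump2 (p - k))).
Proof.
move=> cg; apply: (@integrable_compactly_supported _ _
  (`[k.1, k.1 + e]%classic `*` `[k.2, k.2 + e]%classic)).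
- move=> p; apply: cvgM; first exact: cg.
  exact: (continuous_translate (- k) continuous_bump2 p).
- by apply: compact_setX; exact: segment_compact.
- move=> p /=; rewrite mulf_eq0 negb_or => /andP[_ /bump2_neq0 /= /andP[]].
  by move=> /andP[? ?] /andP[? ?]; split; rewrite /= in_itv/=; apply/andP; split; lra.
Qed.

Let integral_Mbump2 (g : R * R -> R) (k : R * R) : continuous g ->
  \int[leb2]_p (g p * bump2 (p - k)) = \int[leb2]_p (g (p + k) * bump2 p).
Proof.
move=> cg; pose G p := g p * bump2 (p - k).
have cG : continuous G.
  move=> p; apply: cvgM; first exact: cg.
  exact: (continuous_translate (- k) continuous_bump2 p).
have iG : leb2.-integrable setT (EFin \o (fun p => G (p + k))).
  have cgk := continuous_translate k cg.
  have := integrable_Mbump2 0 cgk; congr integrable.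
  by apply/funext => p; rewrite /G /= subr0 addrK.
have := Rintegral_translate (continuous_plane_measurable cG) iG.
move=> <-; apply: eq_Rintegral => p _; by rewrite /G addrK.
Qed.

Let integral_bump2_gt0 : 0 < \int[leb2]_p bump2 p.
Proof.
pose p0 : R * R := (e / 2, e / 2); have Tp0 : 0 < bump2 p0 := bump2_gt0.
have T20 : 0 < bump2 p0 / 2 by rewrite divr_gt0.
have : \forall p \near p0, bump2 p0 / 2 < bump2 p.
  have /cvgr_gt := @continuous_bump2 p0; apply.
  by rewrite ltr_pdivrMr// ltr_pMr// ltr1n.
move=> /nbhs_ballP[d /= d0 dT].
have mB := measurable_plane_ball p0 d.
have : \int[leb2]_p (bump2 p0 / 2 * \1_(ball p0 d) p) <= \int[leb2]_p bump2 p.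
  apply: le_Rintegral => //.
  - rewrite (_ : _ \o _ = fun p => ((bump2 p0 / 2)%:E * (\1_(ball p0 d) p)%:E)%E).
      by apply: integrableZl => //; exact/integrable_plane_ball/ltW.
    by apply/funext => p /=; rewrite EFinM.
  - have -> : bump2 = fun p => cst 1 p * bump2 (p - 0).
      by apply/funext => p /=; rewrite subr0 mul1r.
    by apply: integrable_Mbump2 => p; exact: cvg_cst.
  - move=> p _; rewrite indicE; case: (boolP (p \in _)) => [/set_mem/dT/ltW|_].
      by rewrite mulr1.
    by rewrite mulr0.
apply: lt_le_trans; rewrite RintegralZl//; last exact/integrable_plane_ball/ltW.
apply: mulr_gt0 => //; rewrite /Rintegral integral_indic// setIT.
rewrite [X in fine X](_ : _ = ((d *+ 2) ^+ 2)%:E); last exact/leb2_ball/ltW.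
by rewrite /= exprn_gt0// pmulrn_lgt0.
Qed.

(** The test function is A(x)B(y), where A and B are compactly supported
    primitives of differences of two translates of the bump: its mixed
    derivative is the alternating sum of the translates of [bump2] to the four
    corners, and a change of variables moves each translation from [bump2] to
    [g]. *)
Let integral_mixed_difference (g : R * R -> R) (a a' b b' : R) : continuous g ->
  (forall phi : testfun R,
    regular_dist g (test_partial axis2 (test_partial axis1 phi)) = 0) ->
  \int[leb2]_p (mixed_difference g a a' b b' p * bump2 p) = 0.
Proof.
move=> cg g0.
have [A [CA dA sA]] := Cinfty_primitive_bumpB a a' e0.
have [B [CB dB sB]] := Cinfty_primitive_bumpB b b' e0.
have := g0 (Testfun (mem_set (is_testfun_tensor CA CB sA sB))).
(* The vanishing now concerns the integral of g(x,y) A'(x) B'(y). *)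
rewrite /regular_dist /= (partial_tensor1 _ dA) (partial_tensor2 _ dB).
pose G k p := g p * bump2 (p - k); pose H k p := g (p + k) * bump2 p.
have iG k : leb2.-integrable setT (EFin \o G k) by exact: integrable_Mbump2.
have iH k : leb2.-integrable setT (EFin \o H k).
  have := integrable_Mbump2 0 (continuous_translate k cg); congr integrable.
  by apply/funext => p /=; rewrite subr0.
have iB (u v : R * R -> R) : leb2.-integrable setT (EFin \o u) ->
    leb2.-integrable setT (EFin \o v) ->
    leb2.-integrable setT (EFin \o (fun p => u p - v p)).
  by move=> iu iv; have := integrableB measurableT iu iv.
have comb (u1 u2 u3 u4 : R * R -> R) :
    leb2.-integrable setT (EFin \o u1) -> leb2.-integrable setT (EFin \o u2) ->
    leb2.-integrable setT (EFin \o u3) -> leb2.-integrable setT (EFin \o u4) ->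
    \int[leb2]_p ((u1 p - u2 p) - (u3 p - u4 p)) =
    (\int[leb2]_p u1 p - \int[leb2]_p u2 p) -
    (\int[leb2]_p u3 p - \int[leb2]_p u4 p).
  move=> i1 i2 i3 i4.
  rewrite (RintegralB measurableT (iB _ _ i1 i2) (iB _ _ i3 i4)).
  by rewrite (RintegralB measurableT i1 i2) (RintegralB measurableT i3 i4).
move=> <-.
transitivity (\int[leb2]_p ((H (a, b) p - H (a', b) p) - (H (a, b') p - H (a', b') p))).
  by apply: eq_Rintegral => p _; rewrite /mixed_difference !mulrBl.
transitivity (\int[leb2]_p ((G (a, b) p - G (a', b) p) - (G (a, b') p - G (a', b') p))).
  rewrite (comb _ _ _ _ (iH _) (iH _) (iH _) (iH _)).
  rewrite (comb _ _ _ _ (iG _) (iG _) (iG _) (iG _)).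
  have GH k : \int[leb2]_p G k p = \int[leb2]_p H k p by exact: integral_Mbump2.
  by rewrite (GH (a, b)) (GH (a', b)) (GH (a, b')) (GH (a', b')).
by apply: eq_Rintegral => p _; rewrite /G /bump2 /tensor /=; ring.
Qed.

(** On the support of [bump2] the mixed difference stays within |c|/2 of c, so
    that c times it is at least c^2/2 there; if c were nonzero, its integral
    against [bump2] could not vanish. *)
Lemma mixed_difference_small (g : R * R -> R) (a a' b b' c : R) : continuous g ->
  (forall phi : testfun R,
    regular_dist g (test_partial axis2 (test_partial axis1 phi)) = 0) ->
  (forall p, 0 < p.1 < e -> 0 < p.2 < e ->
    `|mixed_difference g a a' b b' p - c| <= `|c| / 2) ->
  c = 0.
Proof.
move=> cg g0 gc; apply/eqP/negP => /negP c0.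
have iT (u : R * R -> R) : continuous u ->
    leb2.-integrable setT (EFin \o (fun p => u p * bump2 p)).
  move=> cu; have := integrable_Mbump2 0 cu; congr integrable.
  by apply/funext => p /=; rewrite subr0.
have cC := continuous_mixed_difference (a := a) (a' := a') (b := b) (b' := b') cg.
have c2 : 0 < c ^+ 2 / 2 by rewrite divr_gt0// exprn_even_gt0.
have : c ^+ 2 / 2 * \int[leb2]_p bump2 p <=
    c * \int[leb2]_p (mixed_difference g a a' b b' p * bump2 p).
  have iT1 : leb2.-integrable setT (EFin \o bump2).
    have -> : bump2 = fun p => cst 1 p * bump2 p by apply/funext => p /=; rewrite mul1r.
    by apply: iT => p; exact: cvg_cst.
  rewrite -(RintegralZl _ measurableT iT1) -(RintegralZl _ measurableT (iT _ cC)).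
  apply: le_Rintegral => //.
  - have -> : (fun p => c ^+ 2 / 2 * bump2 p) = (fun p => cst (c ^+ 2 / 2) p * bump2 p) by [].
    by apply: iT => p; exact: cvg_cst.
  - have -> : (fun p => c * (mixed_difference g a a' b b' p * bump2 p)) =
        (fun p => (c * mixed_difference g a a' b b' p) * bump2 p).
      by apply/funext => p; rewrite mulrA.
    by apply: iT => p; apply: cvgM; [exact: cvg_cst|exact: cC].
  move=> p _; rewrite mulrA.
  have [->|/bump2_neq0/andP[p1 p2]] := eqVneq (bump2 p) 0; first by rewrite !mulr0.
  rewrite ler_wpM2r//; have := gc p p1 p2; move: (mixed_difference _ _ _ _ _ _) => d.
  by case: (ltP 0 c) => cs; rewrite ?(gtr0_norm cs) ?(ler0_norm cs) ler_norml =>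
    /andP[? ?]; nra.
rewrite integral_mixed_difference// mulr0 leNgt => /negP; apply.
exact/mulr_gt0/integral_bump2_gt0.
Qed.

End weak_mixed_derivative.

(** * Uniqueness of primitives *)

Section uniqueness.
Context {R : realType}.
Notation leb2 := (@lebesgue_measure R \x @lebesgue_measure R)%E.

Lemma weak_mixed_derivative0_mixed_difference (g : R * R -> R) (a a' b b' : R) :
  continuous g ->
  (forall phi : testfun R,
    regular_dist g (test_partial axis2 (test_partial axis1 phi)) = 0) ->
  mixed_difference g a a' b b' 0 = 0.
Proof.
move=> cg g0; set c := mixed_difference g a a' b b' 0.
apply/eqP/negP => /negP c0.
have c20 : 0 < `|c| / 2 by rewrite divr_gt0// normr_gt0.
have /cvgrPdist_lt/(_ _ c20) := @continuous_mixed_difference _ g a a' b b' cg (0 : R * R).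
move=> /nbhs_ballP[e /= e0 eC].
suff : c = 0 by move/eqP; apply/negP.
apply: (mixed_difference_small e0 cg g0 (a := a) (a' := a') (b := b) (b' := b')).
move=> p /andP[p1 pe1] /andP[p2 pe2]; rewrite distrC; apply/ltW/eC.
by split; rewrite /ball/= sub0r normrN gtr0_norm.
Qed.

Lemma cvgr_EFin (T : Type) (G : set_system T) {FG : Filter G} (u : T -> R) (x : R) :
  u @ G --> x -> (u t)%:E @[t --> G] --> x%:E.
Proof.
have EFinx : t%:E @[t --> x] --> x%:E by exact: (@cvg_id _ (nbhs x%:E)).
by move=> ux; exact: cvg_comp ux EFinx.
Qed.

Lemma cvg_EFinNy : (t%:E : \bar R) @[t --> -oo%R] --> -oo%E.
Proof. by apply/cvgerNyP; exact: cvg_id. Qed.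

Lemma cvg_eval_pair (F : \bar R * \bar R -> R) (T : Type) (G : set_system T)
    {FG : Filter G} (u v : T -> \bar R) (x y : \bar R) : continuous F ->
  u @ G --> x -> v @ G --> y -> F (u t, v t) @[t --> G] --> F (x, y).
Proof.
move=> cF ux vy; apply: (cvg_comp2 ux vy (h := fun a b => F (a, b))).
rewrite (_ : (fun _ => _) = F); first exact: cF.
by apply/funext => -[].
Qed.

Lemma continuous_finite_restr (F : \bar R * \bar R -> R) :
  continuous F -> continuous (finite_restr F).
Proof.
move=> cF p; apply: cvg_eval_pair => //.
  by apply: cvgr_EFin; exact: cvg_fst.
by apply: cvgr_EFin; exact: cvg_snd.
Qed.

(** In F(a,b) = F(t,b) + F(a,t) - F(t,t), let t tend to -oo. *)
Lemma weak_mixed_derivative0_finite (F : \bar R * \bar R -> R) : Bc F ->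
  (forall phi : testfun R,
    regular_dist (finite_restr F) (test_partial axis2 (test_partial axis1 phi)) = 0) ->
  forall a b : R, F (a%:E, b%:E) = 0.
Proof.
move=> BF F0 a b; have [cF FNy] := BF.
have rect t : F (a%:E, b%:E) = F (t%:E, b%:E) + (F (a%:E, t%:E) - F (t%:E, t%:E)).
  have := weak_mixed_derivative0_mixed_difference a t b t (continuous_finite_restr cF) F0.
  rewrite /mixed_difference /finite_restr /= !add0r; lra.
have h1 : F (t%:E, b%:E) @[t --> -oo%R] --> F (-oo%E, b%:E).
  by apply: cvg_eval_pair => //; [exact: cvg_EFinNy|exact: cvg_cst].
have h2 : F (a%:E, t%:E) @[t --> -oo%R] --> F (a%:E, -oo%E).
  by apply: cvg_eval_pair => //; [exact: cvg_cst|exact: cvg_EFinNy].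
have h3 : F (t%:E, t%:E) @[t --> -oo%R] --> F (-oo%E, -oo%E).
  by apply: cvg_eval_pair => //; exact: cvg_EFinNy.
rewrite (FNy _).1 in h1; rewrite (FNy _).2 in h2; rewrite (FNy _).1 in h3.
have lim0 : F (t%:E, b%:E) + (F (a%:E, t%:E) - F (t%:E, t%:E)) @[t --> -oo%R]
    --> 0 + (0 - 0 : R).
  exact: cvgD h1 (cvgB h2 h3).
have E0 : (fun t => F (t%:E, b%:E) + (F (a%:E, t%:E) - F (t%:E, t%:E))) =
    cst (F (a%:E, b%:E)).
  by apply/funext => t; exact/esym/rect.
rewrite E0 in lim0; have : F (a%:E, b%:E) = 0 + (0 - 0).
  by apply: (cvg_unique _ _ lim0) => //; exact: cvg_cst.
by rewrite subr0 addr0.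
Qed.

Lemma finite_seq_approx (x : \bar R) : exists u : nat -> R, (u n)%:E @[n --> \oo] --> x.
Proof.
exists (fun n => fine (ereal_loc_seq x n)).
have -> : (fun n => (fine (ereal_loc_seq x n))%:E) = ereal_loc_seq x.
  by apply/funext => n; case: x.
by apply: cvg_trans (@cvg_ereal_loc_seq _ x) _; exact: ereal_dnbhs_le.
Qed.

Lemma weak_mixed_derivative0 (F : \bar R * \bar R -> R) : Bc F ->
  (forall phi : testfun R,
    regular_dist (finite_restr F) (test_partial axis2 (test_partial axis1 phi)) = 0) ->
  F = cst 0.
Proof.
move=> BF F0; apply/funext => -[x y].
have [u ux] := finite_seq_approx x; have [v vy] := finite_seq_approx y.
have := cvg_eval_pair BF.1 ux vy.
have -> : (fun n => F ((u n)%:E, (v n)%:E)) = cst 0.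
  by apply/funext => n; exact: weak_mixed_derivative0_finite.
move=> F0xy; have c0 : cst (0 : R) n @[n --> \oo] --> (0 : R) by exact: cvg_cst.
exact: (cvg_unique _ (F0xy _) c0).
Qed.

Lemma integrable_regular_dist (g : R * R -> R) (phi : testfun R) : continuous g ->
  leb2.-integrable setT (EFin \o (fun p => g p * phi p)).
Proof.
move=> cg; have [sphi cphi] := testfunP phi.
apply: (@integrable_compactly_supported _ _ (tsupport phi)) => //.
- by move=> p; apply: cvgM; [exact: cg|exact: (sphi [::]).1].
- by move=> p /=; rewrite mulf_eq0 negb_or => /andP[_ ?]; exact: subset_closure.
Qed.

Lemma regular_distB (g1 g2 : R * R -> R) (phi : testfun R) :
  continuous g1 -> continuous g2 ->
  regular_dist (g1 - g2) phi = regular_dist g1 phi - regular_dist g2 phi.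
Proof.
move=> c1 c2; have i1 := integrable_regular_dist phi c1.
have i2 := integrable_regular_dist phi c2.
rewrite /regular_dist -(RintegralB measurableT i1 i2).
by apply: eq_Rintegral => p _; rewrite -mulrBl.
Qed.

Lemma dist_partial12 (u : testfun R -> R) (phi : testfun R) :
  dist_partial axis1 (dist_partial axis2 u) phi =
  u (test_partial axis2 (test_partial axis1 phi)).
Proof. by rewrite /dist_partial opprK. Qed.

Lemma primitive_ofB (f1 f2 : testfun R -> R) (F1 F2 : \bar R * \bar R -> R) :
  primitive_of f1 F1 -> primitive_of f2 F2 -> primitive_of (f1 - f2) (F1 - F2).
Proof.
move=> [[c1 b1] ->] [[c2 b2] ->]; split; first split.
- by move=> p; apply: cvgB; [exact: c1|exact: c2].
- move=> s; rewrite !fctE; have [-> ->] := b1 s; have [-> ->] := b2 s.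
  by rewrite subr0.
apply/funext => phi; rewrite !fctE /dist_partial !opprK.
by rewrite -regular_distB//; exact: continuous_finite_restr.
Qed.

Lemma primitive_of_unique (f : testfun R -> R) : is_subset1 (primitive_of f).
Proof.
move=> F G pF pG; have [BFG e] := primitive_ofB pF pG.
apply/eqP; rewrite -subr_eq0; apply/eqP/weak_mixed_derivative0 => // phi.
by have := congr1 (@^~ phi) e; rewrite subrr /dist_partial opprK.
Qed.

Lemma primitive_of_eq (f : testfun R -> R) F : primitive_of f F -> primitive f = F.
Proof. by move=> pF; apply: xget_subset1 => //; exact: primitive_of_unique. Qed.

End uniqueness.

(** * Translations of distributions and of primitives *)

Section translation.
Context {R : realType}.
Notation leb2 := (@lebesgue_measure R \x @lebesgue_measure R)%E.
Implicit Types (h : R * R) (F : \bar R * \bar R -> R) (f u : testfun R -> R).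

Lemma test_translate_lin h a (phi psi : testfun R) :
  test_translate h (a *: phi + psi) = a *: test_translate h phi + test_translate h psi.
Proof. by apply: val_inj; apply/funext => p. Qed.

Lemma tsupport_translate h (phi : R * R -> R) (K : set (R * R)) : compact K ->
  tsupport phi `<=` K -> tsupport (fun_translate h phi) `<=` (fun q => q + h) @` K.
Proof.
move=> cK phiK.
have cK' : compact ((fun q : R * R => q + h) @` K).
  apply: continuous_compact cK; apply: continuous_subspaceT => q.
  by apply: cvgD; [exact: cvg_id|exact: cvg_cst].
rewrite [X in _ `<=` X](iffLR (closure_id _) (compact_closed _ cK')); last first.
  exact: norm_hausdorff.
apply: closureS => p phip; exists (p - h); last by rewrite subrK.
exact/phiK/subset_closure.
Qed.

(** The translated functions are supported in the translate of the common
    compact set, and translation commutes with partial derivatives and does not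
    affect uniform convergence. *)
Lemma testfun_cvg_translate h (phi_ : nat -> testfun R) (phi : testfun R) :
  testfun_cvg phi_ phi ->
  testfun_cvg (fun n => test_translate h (phi_ n)) (test_translate h phi).
Proof.
move=> [[K cK phiK] cphi]; split.
  exists ((fun q => q + h) @` K); last by move=> n; exact: tsupport_translate.
  apply: continuous_compact cK; apply: continuous_subspaceT => q.
  by apply: cvgD; [exact: cvg_id|exact: cvg_cst].
move=> w P /uniform_nbhs[E [entE EP]].
have : nbhs (partials w phi : {uniform R * R -> R})
    [set g | forall y, setT y -> E (partials w phi y, g y)].
  by apply/uniform_nbhs; exists E; split.
move=> /(cphi w) [N _ nE]; exists N => // n /nE /= {}nE.
by apply: EP => y _ /=; rewrite !partials_translate; exact: nE.
Qed.

Lemma is_distribution_translate h f : is_distribution f ->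
  is_distribution (dist_translate h f).
Proof.
move=> [lf cf]; split.
  by move=> a phi psi; rewrite /dist_translate test_translate_lin lf.
by move=> phi_ phi /(testfun_cvg_translate (- h)); exact: cf.
Qed.

Lemma dist_translate0 f : dist_translate 0 f = f.
Proof.
apply/funext => phi; rewrite /dist_translate; congr f.
by apply: val_inj; apply/funext => p; rewrite /= /fun_translate !oppr0 addr0.
Qed.

(** Subtracting a real number fixes both infinities, so that this extends the
    translation of the plane to the extended plane. *)
Definition ext_translate h F (p : \bar R * \bar R) : R :=
  F (p.1 - h.1%:E, p.2 - h.2%:E)%E.

(** Joint continuity in the point and the translation vector is needed for the
    uniform estimate of [near_ext_translate].  Addition of extended reals is
    continuous here because one summand is finite. *)
Lemma continuous_ext_translate F : continuous F ->
  continuous (fun q : (\bar R * \bar R) * (R * R) => ext_translate q.2 F q.1).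
Proof.
move=> cF; have c11 : continuous (fun q : (\bar R * \bar R) * (R * R) => q.1.1).
  by move=> q; apply: (cvg_comp _ _ cvg_fst); exact: cvg_fst.
have c12 : continuous (fun q : (\bar R * \bar R) * (R * R) => q.1.2).
  by move=> q; apply: (cvg_comp _ _ cvg_fst); exact: cvg_snd.
have c21 : continuous (fun q : (\bar R * \bar R) * (R * R) => q.2.1%:E).
  by move=> q; apply: cvgr_EFin; apply: (cvg_comp _ _ cvg_snd); exact: cvg_fst.
have c22 : continuous (fun q : (\bar R * \bar R) * (R * R) => q.2.2%:E).
  by move=> q; apply: cvgr_EFin; apply: (cvg_comp _ _ cvg_snd); exact: cvg_snd.
move=> q; apply: cvg_eval_pair => //.
- by apply: cvgeB (c11 q) (c21 q) => //; case: (q.1.1).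
- by apply: cvgeB (c12 q) (c22 q) => //; case: (q.1.2).
Qed.

Lemma Bc_ext_translate h F : Bc F -> Bc (ext_translate h F).
Proof.
move=> [cF FNy]; split.
  move=> p; have cph := @continuous_ext_translate F cF (p, h).
  have ph : (fun q : \bar R * \bar R => (q, h)) @ p --> (p, h).
    exact: (cvg_pair (@cvg_id _ (nbhs p)) (@cvg_cst _ h _ (nbhs p) _)).
  exact: cvg_comp ph cph.
by move=> s; rewrite /ext_translate /=; split; [exact: (FNy _).1|exact: (FNy _).2].
Qed.

Lemma test_partial_translate i h (phi : testfun R) :
  test_partial i (test_translate h phi) = test_translate h (test_partial i phi).
Proof. by apply: val_inj; exact: partial_translate. Qed.

Lemma regular_dist_translate h (g : R * R -> R) (phi : testfun R) : continuous g ->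
  regular_dist g (test_translate (- h) phi) =
  regular_dist (fun p => g (p + - h)) phi.
Proof.
move=> cg; pose k p := g (p + - h) * phi p.
have kE p : k (p + h) = g p * test_translate (- h) phi p.
  rewrite /k addrK; congr (_ * _); congr (phi _).
  by rewrite opprK.
have ck : continuous k.
  move=> p; apply: cvgM; first exact: continuous_translate.
  exact: ((testfunP phi).1 [::]).1.
have ik : leb2.-integrable setT (EFin \o (fun p => k (p + h))).
  have := integrable_regular_dist (test_translate (- h) phi) cg; congr integrable.
  by apply/funext => p; rewrite /comp kE.
rewrite /regular_dist -(Rintegral_translate (continuous_plane_measurable ck) ik).
by apply: eq_Rintegral => p _; rewrite kE.
Qed.

Lemma primitive_of_translate h f F : primitive_of f F ->
  primitive_of (dist_translate h f) (ext_translate h F).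
Proof.
move=> [BF ->]; have BFh := Bc_ext_translate h BF; refine (conj BFh _).
apply/funext => phi; rewrite dist_partial12.
transitivity (regular_dist (finite_restr F) (test_partial axis2
    (test_partial axis1 (test_translate (- h) phi)))).
  exact: dist_partial12.
rewrite !test_partial_translate.
exact: (regular_dist_translate _ _ (continuous_finite_restr BF.1)).
Qed.

Lemma sup_norm_ext_translate h F : sup_norm (ext_translate h F) = sup_norm F.
Proof.
rewrite /sup_norm; congr sup; apply/seteqP; split => _ [p _ <-].
  by exists (p.1 - h.1%:E, p.2 - h.2%:E)%E.
exists (p.1 + h.1%:E, p.2 + h.2%:E)%E => //.
by rewrite /ext_translate /= !addeK//; case: p.
Qed.

(** Neighbourhoods of the two infinities leave only a real segment to cover. *)
Lemma compact_ereal : compact [set: \bar R].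
Proof.
apply/compact_near_coveringP => I G P FG cover.
have [[U V] /= [[M [_ MU]] GV] UV] := cover +oo%E Logic.I.
have [[U' V'] /= [[m [_ mU']] GV'] UV'] := cover -oo%E Logic.I.
have cK : compact (EFin @` `[m, M]).
  apply: continuous_compact; last exact: segment_compact.
  by apply: continuous_subspaceT => x; apply: cvgr_EFin; exact: cvg_id.
have GK := (compact_near_coveringP _).1 cK I G P FG (fun x _ => cover x Logic.I).
apply: filterS (filterI (filterI GV GV') GK) => i [[Vi V'i] Ki] x _ /=.
have [xm|mx] := ltP x m%:E.
  by apply: (UV' (x, i)); split; [exact: mU'|exact: V'i].
have [Mx|xM] := ltP M%:E x.
  by apply: (UV (x, i)); split; [exact: MU|exact: Vi].
apply: Ki; case: x mx xM => [r||]//; rewrite !lee_fin => mr rM.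
by exists r => //=; rewrite in_itv/= mr rM.
Qed.

(** The estimate holds near each point of the extended plane by joint
    continuity; compactness makes it uniform. *)
Lemma near_ext_translate F (e : R) : continuous F -> 0 < e ->
  \forall h \near (0 : R * R), forall p, `|F p - ext_translate h F p| < e.
Proof.
move=> cF e0.
have cK : compact [set: \bar R * \bar R].
  by rewrite -setXTT; apply: compact_setX; exact: compact_ereal.
have cov (p : \bar R * \bar R) : [set: \bar R * \bar R] p ->
    \forall q \near p & h \near (0 : R * R), `|F q - ext_translate h F q| < e.
  move=> _.
  have c1 : continuous (fun q : (\bar R * \bar R) * (R * R) => F q.1).
    by move=> q; apply: (cvg_comp _ _ cvg_fst); exact: cF.
  have := cvgB (c1 (p, 0)) (@continuous_ext_translate F cF (p, 0)).
  have -> : ext_translate (p, 0 : R * R).2 F (p, 0 : R * R).1 = F p.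
    by rewrite /ext_translate /= !sube0; case: p.
  rewrite subrr => lim0.
  exact: ((cvgr0Pnorm_lt _).1 (lim0 _) e e0).
have nc := (compact_near_coveringP _).1 cK _ (nbhs (0 : R * R))
  (fun h q => `|F q - ext_translate h F q| < e) (nbhs_filter _) cov.
by apply: filterS nc => h hF p; exact: hF.
Qed.

Lemma sup_norm_ge0 F (M : R) : (forall p, `|F p| <= M) -> 0 <= sup_norm F.
Proof.
move=> FM; apply: (le_trans (normr_ge0 (F (0, 0)%E))).
by apply: ub_le_sup; [exists M => _ [p _ <-]|exists (0, 0)%E].
Qed.

End translation.

(** * Translation invariance and continuity of the Alexiewicz norm *)

Theorem proposition7p8 (R : realType) :
  [/\ forall f : testfun R -> R, is_distribution f ->
        (Ac f <-> forall h : R * R, Ac (dist_translate h f)),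
      forall f : testfun R -> R, Ac f ->
        forall h : R * R,
          alexiewicz_norm f = alexiewicz_norm (dist_translate h f)
    & forall f : testfun R -> R, Ac f ->
        alexiewicz_norm (f - dist_translate h f)
          @[h --> (0 : R * R)^'] --> (0 : R)].
Proof.
split=> [f df|f [_ [F pF]] h|f [_ [F pF]]].
- split=> [[_ [F pF]] h|/(_ 0)]; last by rewrite dist_translate0.
  split; first exact: is_distribution_translate.
  by exists (ext_translate h F); exact: primitive_of_translate.
- rewrite /alexiewicz_norm (primitive_of_eq pF).
  by rewrite (primitive_of_eq (primitive_of_translate h pF)) sup_norm_ext_translate.
(* The bound holds on a full neighbourhood of 0, hence on a punctured one. *)
apply/cvgr0Pnorm_le => e e0; apply: cvg_within.
apply: filterS (near_ext_translate pF.1.1 e0) => h Fh.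
rewrite /alexiewicz_norm.
rewrite (primitive_of_eq (primitive_ofB pF (primitive_of_translate h pF))).
have Fe p : `|(F - ext_translate h F) p| <= e by exact/ltW/Fh.
rewrite ger0_norm; last exact: sup_norm_ge0 Fe.
apply: ge_sup => [|_ [p _ <-] //].
by exists `|(F - ext_translate h F) (0, 0)%E|; exists (0, 0)%E.
Qed.
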